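(* Let $N\ge 1$, $n\ge 1$ be integers, let $\mathcal{G}$ be a connected undirected graph on the agents $\{1,\dots,N\}$ with adjacency matrix $[a_{ij}]_{N\times N}$, and let $f_i:\mathbb{R}^n\to\mathbb{R}$ ($i=1,\dots,N$) be twice continuously differentiable, $\gamma_i$-strongly convex and $\psi_i$-smooth with $\gamma_i,\psi_i>0$, and such that $\gamma_i I_n\le\nabla^2 f_i(x)\le\Gamma_i I_n$ for all $x\in\mathbb{R}^n$, with finite $\Gamma_i>0$. Let $x^*\in\mathbb{R}^n$ be the global minimizer of $\tilde f(x)=\sum_{i=1}^N f_i(x)$ over $\mathbb{R}^n$. Let $t_0\ge 0$, $T_1>0$, $h_1>0$, $c,\kappa_1,\kappa_2>0$, and let $\varrho_1$ be the time-varying scaling function with parameters $(t_0,T_1,h_1)$ (defined in the context). Consider the system, for $i=1,\dots,N$, $$\dot x_i(t)=\big(\nabla^2 f_i(x_i(t))\big)^{-1}\Big(\kappa_1\frac{\dot\varrho_1(t)}{\varrho_1(t)}\Big)\Big(-\kappa_2 s_i(t)-c\sum_{j=1}^N a_{ij}\big(x_i(t)-x_j(t)\big)\Big),$$ $$s_i(t)=\nabla f_i(x_i(t))+c\int_{t_0}^t\Big(\kappa_1\frac{\dot\varrho_1(\tau)}{\varrho_1(\tau)}\Big)\sum_{j=1}^N a_{ij}\big(x_i(\tau)-x_j(\tau)\big)\,\mathrm{d}\tau .$$ Then for any initial values $x_i(t_0)\in\mathbb{R}^n$, $i=1,\dots,N$, the algorithm solves the problem $\min_{x\in\mathbb{R}^n}\tilde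 f(x)$ within the single prescribed time interval $T_1$, i.e. the solution satisfies $$\lim_{t\to(t_0+T_1)^-}x_i(t)=x^*\quad\text{for every } i=1,\dots,N.$$
   Context: Graph conventions: the adjacency matrix of the undirected graph $\mathcal{G}$ is symmetric with non-negative entries, $a_{ij}>0$ if and only if $\{i,j\}$ is an edge, and $a_{ii}=0$. Function conventions: $f_i$ is $\gamma_i$-strongly convex if $f_i(x)-f_i(y)-\nabla f_i(y)^\top(x-y)\ge\frac{\gamma_i}{2}\|x-y\|^2$ for all $x,y$; $f_i$ is $\psi_i$-smooth if $\nabla f_i$ is Lipschitz with constant $\psi_i$. Matrix inequalities are in the positive semidefinite order. Time-varying scaling function: $$\varrho_1(t)=\begin{cases}\dfrac{T_1^{h_1}}{(T_1+t_0-t)^{h_1}}, & t\in[t_0,t_0+T_1),\\ 1,&\text{otherwise,}\end{cases}$$ so that $\dot\varrho_1(t)/\varrho_1(t)=h_1/(T_1+t_0-t)$ on $[t_0,t_0+T_1)$ (right derivative at $t_0$). A solution means continuous functions $x_i:[t_0,t_0+T_1)\to\mathbb{R}^n$ that are differentiable on $(t_0,t_0+T_1)$ and satisfy the displayed system there. *)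

(* Defs.v *)
From HB Require Import structures.
From mathcomp Require Import all_boot all_order all_algebra.
From mathcomp Require Import all_classical all_reals all_analysis.

Set Implicit Arguments.
Unset Strict Implicit.
Unset Printing Implicit Defensive.

Import Order.TTheory GRing.Theory Num.Theory.
Import numFieldNormedType.Exports.

Local Open Scope classical_set_scope.
Local Open Scope ring_scope.

(* The norm `|v| that the library puts on matrices is the sup norm, which
   induces the same topology (hence the same limits and derivatives) but not
   the same constants in strong convexity and smoothness. *)
Definition enorm (R : realType) (n : nat) (v : 'cV[R]_n) : R :=
  Num.sqrt (\sum_(k < n) v k 0 ^+ 2).

Definition psdmx (R : realType) (n : nat) (A : 'M[R]_n) : Prop :=
  A^T = A /\ forall v : 'cV[R]_n, 0 <= (v^T *m A *m v) 0 0.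

Definition lemx_psd (R : realType) (n : nat) (A B : 'M[R]_n) : Prop :=
  psdmx (B - A).

Definition grad (R : realType) (n : nat) (f : 'cV[R]_n -> R) (x : 'cV[R]_n) :
    'cV[R]_n :=
  \col_(k < n) 'D_(delta_mx k 0) f x.

Definition hess (R : realType) (n : nat) (f : 'cV[R]_n -> R) (x : 'cV[R]_n) :
    'M[R]_n :=
  \matrix_(k < n, l < n) 'D_(delta_mx l 0) (fun y => grad f y k 0) x.

Definition twice_continuously_differentiable (R : realType) (n : nat)
    (f : 'cV[R]_n -> R) : Prop :=
  [/\ forall x, differentiable f x,
      forall x, differentiable (grad f) x
    & continuous (hess f)].

Definition strongly_convex (R : realType) (n : nat) (gamma : R)
    (f : 'cV[R]_n -> R) : Prop :=
  forall x y : 'cV[R]_n,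
    gamma / 2 * enorm (x - y) ^+ 2
      <= f x - f y - ((grad f y)^T *m (x - y)) 0 0.

Definition smooth (R : realType) (n : nat) (psi : R)
    (f : 'cV[R]_n -> R) : Prop :=
  forall x y : 'cV[R]_n, enorm (grad f x - grad f y) <= psi * enorm (x - y).

Definition undirected_graph (N : nat) (e : rel 'I_N) : Prop :=
  symmetric e /\ irreflexive e.

Definition connected_graph (N : nat) (e : rel 'I_N) : Prop :=
  forall i j : 'I_N, connect e i j.

Definition adjacency_matrix (R : realType) (N : nat) (e : rel 'I_N)
    (a : 'M[R]_N) : Prop :=
  [/\ a^T = a,
      forall i j, 0 <= a i j,
      forall i j, (0 < a i j) = e i j
    & forall i, a i i = 0].

Definition global_minimizer (R : realType) (n : nat) (F : 'cV[R]_n -> R)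
    (xs : 'cV[R]_n) : Prop :=
  forall y : 'cV[R]_n, F xs <= F y.

Definition rho (R : realType) (t0 T h t : R) : R :=
  if t0 <= t < t0 + T then T `^ h / (T + t0 - t) `^ h else 1.

(* rho has a corner at t0, where its derivative is the right derivative. *)
Definition rho_dot (R : realType) (t0 T h t : R) : R :=
  if t == t0
  then lim ((fun d : R => d^-1 * (rho t0 T h (t0 + d) - rho t0 T h t0))
              @ (0 : R)^'+)
  else derive1 (rho t0 T h) t.

Definition gain (R : realType) (t0 T h kappa1 t : R) : R :=
  kappa1 * (rho_dot t0 T h t / rho t0 T h t).

Definition disagreement (R : realType) (N n : nat) (a : 'M[R]_N)
    (x : 'I_N -> R -> 'cV[R]_n) (i : 'I_N) (t : R) : 'cV[R]_n :=
  \sum_(j < N) a i j *: (x i t - x j t).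

Definition s_aux (R : realType) (N n : nat) (f : 'I_N -> 'cV[R]_n -> R)
    (a : 'M[R]_N) (t0 T h c kappa1 : R) (x : 'I_N -> R -> 'cV[R]_n)
    (i : 'I_N) (t : R) : 'cV[R]_n :=
  grad (f i) (x i t) +
  c *: \col_(k < n)
         (\int[@lebesgue_measure R]_(tau in `[t0, t])
            (gain t0 T h kappa1 tau *: disagreement a x i tau) k 0)%R.

(* The trajectories are total functions of time; only their values on
   [t0, t0 + T) are constrained. *)
Definition is_solution (R : realType) (N n : nat) (f : 'I_N -> 'cV[R]_n -> R)
    (a : 'M[R]_N) (t0 T h c kappa1 kappa2 : R)
    (x : 'I_N -> R -> 'cV[R]_n) : Prop :=
  forall i : 'I_N,
    {within `[t0, t0 + T[, continuous (x i)} /\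
    forall t : R, t0 < t < t0 + T ->
      is_derive t (1 : R) (x i)
        (invmx (hess (f i) (x i t)) *m
          (gain t0 T h kappa1 t *:
            (- (kappa2 *: s_aux f a t0 T h c kappa1 x i t)
             - c *: disagreement a x i t))).

(* Main.v *)
(* Along a solution, the gradients y_i = grad f_i(x_i) satisfy
   y_i' = g (- kappa2 s_i - c (L x)_i), where g is the gain and L the graph
   Laplacian, so s_i' = - kappa2 g s_i, and sum s_i = sum y_i because the
   Laplacian terms cancel. Let V be the sum of the Bregman divergences
   D_{f_i}(xs, x_i); then
     V' = g (- kappa2 sum <s_i, x_i - xs> - c <x, L x>).
   Connectedness together with strong convexity gives
     sum |x_i - xs|^2 <= K (<x, L x> + sum |s_i|^2),
   so U = V + beta sum |s_i|^2 satisfies U' <= - mu g U for suitable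
   beta, mu > 0. As g = kappa1 h1 / (t0 + T1 - t), this means
   U = O((t0 + T1 - t)^(mu kappa1 h1)), and V dominates every |x_i - xs|^2. *)
Require Import Defs.
From HB Require Import structures.
From mathcomp Require Import all_boot all_order all_algebra.
From mathcomp Require Import all_classical all_reals all_analysis.
From mathcomp Require Import ring lra.

Set Implicit Arguments.
Unset Strict Implicit.
Unset Printing Implicit Defensive.

Import Order.TTheory GRing.Theory Num.Theory.
Import numFieldNormedType.Exports.

Local Open Scope classical_set_scope.
Local Open Scope ring_scope.

(** * Euclidean inner product and elementary inequalities *)

Section EuclideanInnerProduct.
Context {R : realType} {n : nat}.
Implicit Types u v w : 'cV[R]_n.

Definition vdot u v : R := \sum_(k < n) u k 0 * v k 0.

Lemma vdotE u v : (u^T *m v) 0 0 = vdot u v.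
Proof. by rewrite mxE; apply: eq_bigr => k _; rewrite mxE. Qed.

Lemma vdotC u v : vdot u v = vdot v u.
Proof. by apply: eq_bigr => k _; rewrite mulrC. Qed.

Lemma vdotDl u v w : vdot (u + v) w = vdot u w + vdot v w.
Proof. by rewrite -big_split; apply: eq_bigr => k _; rewrite mxE mulrDl. Qed.

Lemma vdotZl a u v : vdot (a *: u) v = a * vdot u v.
Proof. by rewrite mulr_sumr; apply: eq_bigr => k _; rewrite mxE mulrA. Qed.

Lemma vdotNl u v : vdot (- u) v = - vdot u v.
Proof. by rewrite -scaleN1r vdotZl mulN1r. Qed.

Lemma vdotBl u v w : vdot (u - v) w = vdot u w - vdot v w.
Proof. by rewrite vdotDl vdotNl. Qed.

Lemma vdotDr u v w : vdot w (u + v) = vdot w u + vdot w v.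
Proof. by rewrite !(vdotC w) vdotDl. Qed.

Lemma vdotZr a u v : vdot u (a *: v) = a * vdot u v.
Proof. by rewrite !(vdotC u) vdotZl. Qed.

Lemma vdotNr u v : vdot u (- v) = - vdot u v.
Proof. by rewrite !(vdotC u) vdotNl. Qed.

Lemma vdotBr u v w : vdot w (u - v) = vdot w u - vdot w v.
Proof. by rewrite vdotDr vdotNr. Qed.

Lemma vdot0l u : vdot 0 u = 0.
Proof. by rewrite -(scale0r 0) vdotZl mul0r. Qed.

Lemma vdot_suml I (r : seq I) (P : pred I) (F : I -> 'cV[R]_n) v :
  vdot (\sum_(i <- r | P i) F i) v = \sum_(i <- r | P i) vdot (F i) v.
Proof.
by elim/big_rec2: _ => [|i a b _ <-]; rewrite ?vdot0l ?vdotDl.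
Qed.

Lemma vdot_ge0 u : 0 <= vdot u u.
Proof. by apply: sumr_ge0 => k _; rewrite -expr2 sqr_ge0. Qed.

Lemma coord_le_vdot u k : u k 0 ^+ 2 <= vdot u u.
Proof.
rewrite /vdot (bigD1 k) //= -expr2 lerDl.
by apply: sumr_ge0 => l _; rewrite -expr2 sqr_ge0.
Qed.

Lemma vdot_le0_eq0 u : vdot u u <= 0 -> u = 0.
Proof.
move=> u0; apply/matrixP => k l; rewrite (ord1 l) mxE.
apply/eqP; rewrite -sqrf_eq0 eq_le sqr_ge0 andbT.
exact: le_trans (coord_le_vdot u k) u0.
Qed.

Lemma enorm_sqr u : enorm u ^+ 2 = vdot u u.
Proof.
have E : \sum_(k < n) u k 0 ^+ 2 = vdot u u.
  by apply: eq_bigr => k _; rewrite expr2.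
by rewrite /enorm E sqr_sqrtr // vdot_ge0.
Qed.

(** Expand the square of [eta *: u - v] and divide by [eta]. A factor 1/2 is given away on the
    right, since only the existence of constants matters later. *)
Lemma vdot_young eta u v : 0 < eta ->
  vdot u v <= eta * vdot u u + eta^-1 * vdot v v.
Proof.
move=> eta0; have := vdot_ge0 (eta *: u - v).
rewrite !(vdotBl, vdotBr, vdotZl, vdotZr) (vdotC v u) => h.
have uu : 0 <= eta * (eta * vdot u u) by rewrite !mulr_ge0 ?vdot_ge0 // ltW.
have vv := vdot_ge0 v.
rewrite -(ler_pM2l eta0) mulrDr mulVKf ?gt_eqF //.
lra.
Qed.

Lemma vdot_sqrD u v : vdot (u + v) (u + v) <= 2 * vdot u u + 2 * vdot v v.
Proof.
have := vdot_ge0 (u - v).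
by rewrite !(vdotBl, vdotBr, vdotDl, vdotDr) (vdotC v u); lra.
Qed.

End EuclideanInnerProduct.

(** * Graph Laplacian and the consensus inequality *)

Section GraphLaplacian.
Context {R : realType} {N n : nat} (e : rel 'I_N) (a : 'M[R]_N).
Hypothesis ha : adjacency_matrix e a.
Implicit Types z : 'I_N -> 'cV[R]_n.

Definition laplacian z (i : 'I_N) : 'cV[R]_n :=
  \sum_(j < N) a i j *: (z i - z j).

(** Each edge is counted in both orientations, so this is twice the quadratic form of the
    Laplacian. *)
Definition edge_energy z : R :=
  \sum_(i < N) \sum_(j < N) a i j * vdot (z i - z j) (z i - z j).

Lemma adjacency_sym i j : a i j = a j i.
Proof. by case: ha => aT _ _ _; rewrite -{1}aT mxE. Qed.

(** Exchanging [i] and [j] flips the sign of every term, so the sum equals its own opposite. *)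
Lemma sum_laplacian z : \sum_(i < N) laplacian z i = 0.
Proof.
have E : \sum_(i < N) laplacian z i = - \sum_(i < N) laplacian z i.
  rewrite [LHS]exchange_big /= -sumrN; apply: eq_bigr => i _.
  rewrite /laplacian -sumrN; apply: eq_bigr => j _.
  by rewrite adjacency_sym -scalerN opprB.
have : 2 *: \sum_(i < N) laplacian z i = 0.
  by rewrite scaler_nat mulr2n {1}E addNr.
by move/eqP; rewrite scaler_eq0 pnatr_eq0 => /eqP.
Qed.

(** Exchanging [i] and [j] turns the pairing with [z i] into a pairing with [- z j]; adding the two
    forms produces the squares. *)
Lemma vdot_laplacian z :
  \sum_(i < N) vdot (laplacian z i) (z i) = edge_energy z / 2.
Proof.
have E1 : \sum_(i < N) vdot (laplacian z i) (z i) =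
    \sum_(i < N) \sum_(j < N) a i j * vdot (z i - z j) (z i).
  apply: eq_bigr => i _; rewrite /laplacian vdot_suml.
  by apply: eq_bigr => j _; rewrite vdotZl.
have E2 : \sum_(i < N) vdot (laplacian z i) (z i) =
    \sum_(i < N) \sum_(j < N) a i j * vdot (z i - z j) (- z j).
  rewrite E1 exchange_big; apply: eq_bigr => i _ /=; apply: eq_bigr => j _.
  by rewrite adjacency_sym vdotNr -vdotNl opprB.
suff : edge_energy z = (\sum_(i < N) vdot (laplacian z i) (z i)) * 2.
  by move=> ->; rewrite mulfK // pnatr_eq0.
rewrite mulr_natr mulr2n {1}E1 E2 -big_split; apply: eq_bigr => i _.
rewrite -big_split; apply: eq_bigr => j _ /=.
by rewrite -mulrDr -vdotDr.
Qed.

Lemma edge_energy_term_ge0 z i j : 0 <= a i j * vdot (z i - z j) (z i - z j).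
Proof. by apply: mulr_ge0 (vdot_ge0 _); case: ha. Qed.

Lemma edge_energy_ge0 z : 0 <= edge_energy z.
Proof.
by apply: sumr_ge0 => i _; apply: sumr_ge0 => j _; apply: edge_energy_term_ge0.
Qed.

Lemma edge_le_energy z i j :
  a i j * vdot (z i - z j) (z i - z j) <= edge_energy z.
Proof.
rewrite /edge_energy (bigD1 i) //= (bigD1 j) //= -addrA lerDl.
apply: addr_ge0; apply: sumr_ge0 => k _; last apply: sumr_ge0 => l _;
  exact: edge_energy_term_ge0.
Qed.

(** Induction along the path: each edge costs its inverse weight and a factor 2 from squaring a sum.
    [C] depends on the path only, hence it precedes [z]. *)
Lemma path_le_energy i p : path e i p -> exists2 C, 0 <= C &
  forall z, vdot (z i - z (last i p)) (z i - z (last i p)) <= C * edge_energy z.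
Proof.
elim: p i => [|j p IH] i /=.
  by exists 0 => // z; rewrite subrr vdot0l mul0r.
move=> /andP[eij /IH[C C0 hC]].
have aij : 0 < a i j by case: ha => _ _ -> _.
exists (2 * (a i j)^-1 + 2 * C) => [|z].
  by rewrite addr_ge0 ?mulr_ge0 ?invr_ge0 // ltW.
rewrite -(subrKA (z j)); apply: le_trans (vdot_sqrD _ _) _.
rewrite [leRHS]mulrDl -!mulrA.
by apply: lerD; rewrite ler_pM2l // ler_pdivlMl // edge_le_energy.
Qed.

(** A Poincare inequality for the graph, obtained from paths to [i0] rather than from the spectrum
    of the Laplacian. *)
Lemma consensus_le_energy (i0 : 'I_N) : connected_graph e ->
  exists2 C, 0 < C & forall z,
    \sum_(i < N) vdot (z i - z i0) (z i - z i0) <= C * edge_energy z.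
Proof.
move=> hconn.
have /choice[C hC] : forall i, exists C, 0 <= C /\
    forall z, vdot (z i - z i0) (z i - z i0) <= C * edge_energy z.
  move=> i; have /connectP[p /path_le_energy[C C0 hC] ->] := hconn i i0.
  by exists C.
(* The path constants may all vanish, as for a single agent; the added 1 makes the total
   positive. *)
exists (1 + \sum_(i < N) C i) => [|z].
  by rewrite ltr_pwDl // sumr_ge0 // => i _; case: (hC i).
rewrite mulrDl mul1r mulr_suml -[leLHS]add0r lerD ?edge_energy_ge0 //.
by apply: ler_sum => i _; case: (hC i).
Qed.

End GraphLaplacian.

(** * Bregman divergence of a smooth strongly convex function *)

Definition bregman {R : realType} {n : nat} (f : 'cV[R]_n -> R)
    (x y : 'cV[R]_n) : R := f x - f y - vdot (grad f y) (x - y).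

Section SmoothStronglyConvex.
Context {R : realType} {n : nat} (f : 'cV[R]_n -> R) (gamma psi : R).
Hypotheses (hgamma : 0 < gamma) (hpsi : 0 < psi).
Hypotheses (hconv : strongly_convex gamma f) (hsmooth : smooth psi f).
Implicit Types x y : 'cV[R]_n.

Lemma bregman_ge x y : gamma / 2 * vdot (x - y) (x - y) <= bregman f x y.
Proof. by rewrite -enorm_sqr /bregman -vdotE; exact: hconv. Qed.

Lemma bregman_ge0 x y : 0 <= bregman f x y.
Proof.
apply: le_trans (bregman_ge x y).
by rewrite mulr_ge0 ?vdot_ge0 // divr_ge0 // ltW.
Qed.

Lemma bregman_sum x y :
  bregman f x y + bregman f y x = vdot (grad f x - grad f y) (x - y).
Proof.
by rewrite /bregman vdotBl -(opprB x y) vdotNr; ring.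
Qed.

Lemma vdot_subC x y : vdot (x - y) (x - y) = vdot (y - x) (y - x).
Proof. by rewrite -(opprB y x) vdotNl vdotNr opprK. Qed.

Lemma grad_strongly_monotone x y :
  gamma * vdot (x - y) (x - y) <= vdot (grad f x - grad f y) (x - y).
Proof.
rewrite -bregman_sum; have := bregman_ge x y; have := bregman_ge y x.
by rewrite (vdot_subC y x); lra.
Qed.

Lemma grad_lipschitz_sqr x y :
  vdot (grad f x - grad f y) (grad f x - grad f y)
    <= psi ^+ 2 * vdot (x - y) (x - y).
Proof.
rewrite -!enorm_sqr -exprMn ler_pXn2r ?hsmooth // nnegrE ?sqrtr_ge0 //.
by rewrite mulr_ge0 ?sqrtr_ge0 // ltW.
Qed.

(** Young's inequality with weight 1 replaces Cauchy-Schwarz, which is why [psi ^+ 2 + 1] stands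
    where [psi] would do. *)
Lemma vdot_grad_le x y :
  vdot (grad f x - grad f y) (x - y) <= (psi ^+ 2 + 1) * vdot (x - y) (x - y).
Proof.
apply: le_trans (vdot_young _ _ ltr01) _.
by rewrite invr1 !mul1r mulrDl mul1r lerD2r grad_lipschitz_sqr.
Qed.

(** The reverse divergence is nonnegative, so the symmetrised one is an upper bound; no integration
    along a segment is involved. *)
Lemma bregman_le x y : bregman f x y <= (psi ^+ 2 + 1) * vdot (x - y) (x - y).
Proof.
apply: le_trans (vdot_grad_le x y).
by rewrite -bregman_sum lerDl bregman_ge0.
Qed.

End SmoothStronglyConvex.

(** * Distance to the minimizer *)

Section OptimalityGap.
Context {R : realType} {N n : nat} (f : 'I_N -> 'cV[R]_n -> R).
Context (gamma psi : 'I_N -> R).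
Hypotheses (hgamma : forall i, 0 < gamma i) (hpsi : forall i, 0 < psi i).
Hypotheses (hconv : forall i, strongly_convex (gamma i) (f i)).
Hypotheses (hsmooth : forall i, smooth (psi i) (f i)).
Context (xs : 'cV[R]_n).
Hypothesis hxs : global_minimizer (fun y => \sum_(i < N) f i y) xs.

Let M : R := 1 + \sum_(i < N) (psi i ^+ 2 + 1).

Let M_ge1 : 1 <= M.
Proof. by rewrite lerDl sumr_ge0 // => i _; rewrite addr_ge0 ?sqr_ge0. Qed.

Let psi_le_M i : psi i ^+ 2 + 1 <= M.
Proof.
rewrite /M (bigD1 i) //= addrCA lerDl addr_ge0 // sumr_ge0 // => j _.
by rewrite addr_ge0 ?sqr_ge0.
Qed.

Lemma gamma_lower_bound : exists2 m, 0 < m & forall i, m <= gamma i.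
Proof.
have S0 : 0 <= \sum_(i < N) (gamma i)^-1.
  by apply: sumr_ge0 => i _; rewrite invr_ge0 ltW.
(* Each [(gamma i)^-1] is at most the sum, so this is a common lower bound; the 1 keeps it positive
   even for an empty sum. *)
exists (1 + \sum_(i < N) (gamma i)^-1)^-1 => [|i].
  by rewrite invr_gt0 ltr_pwDl.
rewrite -[leRHS]invrK lef_pV2 ?posrE ?invr_gt0 ?ltr_pwDl //.
rewrite (bigD1 i) //= addrCA lerDl addr_ge0 // sumr_ge0 // => j _.
by rewrite invr_ge0 ltW.
Qed.

(* The upper quadratic model of the sum at the minimizer, evaluated along its
   gradient, already forces that gradient to vanish. *)
Lemma sum_grad_minimizer : \sum_(i < N) grad (f i) xs = 0.
Proof.
set G := \sum_(i < N) _.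
pose K := \sum_(i < N) (psi i ^+ 2 + 1).
have K0 : 0 <= K by apply: sumr_ge0 => i _; rewrite addr_ge0 ?sqr_ge0.
have quad d : 0 <= vdot G d + K * vdot d d.
  have := hxs (xs + d); rewrite -subr_ge0 -sumrB => /le_trans; apply.
  rewrite /K mulr_suml vdot_suml -big_split; apply: ler_sum => i _.
  have := bregman_le (hgamma i) (hpsi i) (hconv i) (hsmooth i) (xs + d) xs.
  by rewrite /bregman [xs + d - xs]addrAC subrr add0r /=; lra.
apply: vdot_le0_eq0.
(* With this step length [eta * K - 1 <= - 1 / 2], so the model is negative at [- eta *: G] unless
   [G] vanishes. *)
pose eta := (2 * (K + 1))^-1.
have eta0 : 0 < eta by rewrite invr_gt0 mulr_gt0 // ltr_wpDl.
have := quad (- eta *: G).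
rewrite !(vdotZl, vdotZr) => h.
have GG := vdot_ge0 G.
have etaK : eta * (K + 1) = 1 / 2.
  by rewrite /eta; field; rewrite gt_eqF // ltr_wpDl.
have : 0 <= eta * (vdot G G * (eta * K - 1)) by lra.
rewrite pmulr_rge0 // => h2.
have h3 : 0 <= vdot G G * (- (1 / 2)).
  apply: le_trans h2 _; apply: ler_wpM2l => //; lra.
lra.
Qed.

(* Since the gradients at xs sum to zero, strong monotonicity bounds the gap by
   the pairing of grad (f i) (x i) - grad (f i) xs with
   (x i - x i0) + (x i0 - xs); the second summand only meets the sum of the
   gradients, which equals the sum of the s i. *)
Lemma optimality_gap_le (i0 : 'I_N) : exists2 K, 0 < K &
  forall x s : 'I_N -> 'cV[R]_n,
    \sum_(i < N) s i = \sum_(i < N) grad (f i) (x i) ->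
    \sum_(i < N) vdot (x i - xs) (x i - xs) <=
      K * (\sum_(i < N) vdot (x i - x i0) (x i - x i0)
           + \sum_(i < N) vdot (s i) (s i)).
Proof.
have [m m0 hm] := gamma_lower_bound.
have M0 : 0 < M by apply: lt_le_trans M_ge1.
have N0 : 0 < N%:R :> R by rewrite ltr0n; case: (N) i0 => [[]|].
(* Each of the two Young inequalities below then costs [m * Z / 4], which leaves [m * Z / 2] on the
   left. [N%:R] enters because [x i0 - xs] is paired with all the [s i]. *)
pose eta := m / (4 * M); pose eta' := m / (4 * N%:R).
have eta0 : 0 < eta by rewrite divr_gt0 // mulr_gt0.
have eta'0 : 0 < eta' by rewrite divr_gt0 // mulr_gt0.
exists (2 / m * (eta^-1 + eta'^-1)) => [|x s ss].
  by rewrite mulr_gt0 ?divr_gt0 ?addr_gt0 ?invr_gt0.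
set Z := \sum_(i < N) _; set D := \sum_(i < N) _; set S := \sum_(i < N) _.
have D0 : 0 <= D by apply: sumr_ge0 => i _; apply: vdot_ge0.
have S0 : 0 <= S by apply: sumr_ge0 => i _; apply: vdot_ge0.
have zZ i : vdot (x i - xs) (x i - xs) <= Z.
  rewrite /Z (bigD1 i) //= lerDl.
  by apply: sumr_ge0 => j _; apply: vdot_ge0.
pose p i := grad (f i) (x i) - grad (f i) xs.
have sp : \sum_(i < N) p i = \sum_(i < N) s i.
  by rewrite /p sumrB sum_grad_minimizer subr0 ss.
have mono : m * Z <= \sum_(i < N) vdot (p i) (x i - xs).
  rewrite mulr_sumr; apply: ler_sum => i _.
  apply: le_trans (grad_strongly_monotone (hconv i) (x i) xs).
  by rewrite ler_wpM2r ?vdot_ge0.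
have split : \sum_(i < N) vdot (p i) (x i - xs) =
    \sum_(i < N) vdot (p i) (x i - x i0) + \sum_(i < N) vdot (x i0 - xs) (s i).
  under [X in _ = _ + X]eq_bigr do rewrite vdotC.
  rewrite -(vdot_suml _ _ s) -sp vdot_suml -big_split; apply: eq_bigr => i _.
  by rewrite /= -vdotDr subrKA.
have le1 : \sum_(i < N) vdot (p i) (x i - x i0) <= eta * (M * Z) + eta^-1 * D.
  rewrite !mulr_sumr -big_split; apply: ler_sum => i _.
  apply: le_trans (vdot_young _ _ eta0) _.
  rewrite lerD2r ler_pM2l //.
  apply: le_trans (grad_lipschitz_sqr (hpsi i) (hsmooth i) _ _) _.
  by rewrite ler_wpM2r ?vdot_ge0 //; have := psi_le_M i; lra.
have le2 : \sum_(i < N) vdot (x i0 - xs) (s i)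
    <= eta' * (N%:R * Z) + eta'^-1 * S.
  have -> : N%:R * Z = \sum_(i < N) Z.
    by rewrite sumr_const card_ord mulr_natl.
  rewrite [eta' * _]mulr_sumr [_^-1 * _]mulr_sumr -big_split.
  apply: ler_sum => i _.
  apply: le_trans (vdot_young _ _ eta'0) _.
  by rewrite lerD2r ler_pM2l.
have e1 : eta * (M * Z) = m * Z / 4 by rewrite /eta; field; rewrite gt_eqF.
have e2 : eta' * (N%:R * Z) = m * Z / 4 by rewrite /eta'; field; rewrite gt_eqF.
have i1 : 0 <= eta^-1 * S by rewrite mulr_ge0 // invr_ge0 ltW.
have i2 : 0 <= eta'^-1 * D by rewrite mulr_ge0 // invr_ge0 ltW.
rewrite -(ler_pM2l m0).
have -> : m * (2 / m * (eta^-1 + eta'^-1) * (D + S)) =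
  2 * (eta^-1 * D + eta'^-1 * S + (eta^-1 * S + eta'^-1 * D)).
  by field; rewrite !gt_eqF.
lra.
Qed.

(** * Lyapunov function and its dissipation *)

Context (e : rel 'I_N) (a : 'M[R]_N).
Hypotheses (hconn : connected_graph e) (ha : adjacency_matrix e a).

Definition lyapunov (beta : R) (x s : 'I_N -> 'cV[R]_n) : R :=
  \sum_(i < N) bregman (f i) xs (x i) + beta * \sum_(i < N) vdot (s i) (s i).

(** The left side is the time derivative of the Lyapunov function divided by the gain. Time is
    thereby eliminated: [x] and [s] are linked only by the equality of sums. *)
Lemma lyapunov_dissipation (i0 : 'I_N) (c kappa : R) : 0 < c -> 0 < kappa ->
  exists beta mu, [/\ 0 < beta, 0 < mu & forall x s : 'I_N -> 'cV[R]_n,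
    \sum_(i < N) s i = \sum_(i < N) grad (f i) (x i) ->
    \sum_(i < N) vdot (- (kappa *: s i) - c *: laplacian a x i) (x i - xs)
      + beta * \sum_(i < N) (- (2 * kappa) * vdot (s i) (s i))
    <= - mu * lyapunov beta x s].
Proof.
move=> c0 k0.
have [C C0 hC] := consensus_le_energy (n := n) ha i0 hconn.
have [K1 K10 hK1] := optimality_gap_le i0.
have M0 : 0 < M by apply: lt_le_trans M_ge1.
(* Chosen so that [Z <= K * (E + S)]. *)
pose K := K1 * (C + 1).
have K0 : 0 < K by rewrite mulr_gt0 // addr_gt0.
(* The Young term in [Z] then costs at most [c * (E + S) / 4], and [mu * V] will cost as much again.
   The consensus term [c * E / 2] pays for the [E] part exactly. *)
pose eta := c / (4 * K * kappa).
have eta0 : 0 < eta by rewrite divr_gt0 // mulr_gt0 // mulr_gt0.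
(* Of the decay [2 * kappa * beta * S], one half dominates [mu * beta * S]; the other half pays for
   the Young term in [S] and for the remaining [c * S / 2]. *)
pose beta := eta^-1 + c / (2 * kappa).
have beta0 : 0 < beta by rewrite addr_gt0 ?invr_gt0 // divr_gt0 // mulr_gt0.
have q0 : 0 < c / (4 * K * M) by rewrite divr_gt0 // mulr_gt0 // mulr_gt0.
pose mu := Num.min (c / (4 * K * M)) kappa.
have mu0 : 0 < mu by rewrite lt_min q0.
exists beta, mu; split => // x s ss.
set S := \sum_(i < N) vdot (s i) (s i).
pose Z := \sum_(i < N) vdot (x i - xs) (x i - xs).
pose E := edge_energy a x.
pose V := \sum_(i < N) bregman (f i) xs (x i).
have E0 : 0 <= E := edge_energy_ge0 ha x.
have S0 : 0 <= S by apply: sumr_ge0 => i _; apply: vdot_ge0.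
have V0 : 0 <= V.
  apply: sumr_ge0 => i _. exact: bregman_ge0 (hconv i) _ _.
have ZK : Z <= K * (E + S).
  apply: le_trans (hK1 x s ss) _; rewrite /K -mulrA ler_pM2l //.
  apply: le_trans (_ : C * E + S <= _); first by rewrite lerD2r hC.
  have := mulr_ge0 (ltW C0) S0; lra.
have VZ : V <= M * Z.
  rewrite mulr_sumr; apply: ler_sum => i _.
  apply: le_trans (bregman_le (hgamma i) (hpsi i) (hconv i) (hsmooth i) _ _) _.
  by rewrite vdot_subC ler_wpM2r ?vdot_ge0.
(* The common vector [xs] drops out because the Laplacian sums to zero. *)
have lap : \sum_(i < N) vdot (laplacian a x i) (x i - xs) = E / 2.
  rewrite -(vdot_laplacian ha) (eq_bigr _ (fun i _ => vdotBr _ _ _)) sumrB.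
  by rewrite -(vdot_suml _ _ (laplacian a x)) (sum_laplacian ha) vdot0l subr0.
have cross : - \sum_(i < N) vdot (s i) (x i - xs) <= eta * Z + eta^-1 * S.
  rewrite -sumrN [eta * _]mulr_sumr [_^-1 * _]mulr_sumr -big_split.
  apply: ler_sum => i _.
  have := vdot_young (- (x i - xs)) (s i) eta0.
  by rewrite !vdotNl vdotNr opprK (vdotC _ (s i)).
have -> : \sum_(i < N) vdot (- (kappa *: s i) - c *: laplacian a x i) (x i - xs)
    = - kappa * (\sum_(i < N) vdot (s i) (x i - xs)) - c * (E / 2).
  rewrite -lap !mulr_sumr -sumrB; apply: eq_bigr => i _.
  by rewrite vdotBl vdotNl !vdotZl mulNr.
rewrite -mulr_sumr -/S /lyapunov -/V -/S.
have muV : mu * V <= c * Z / (4 * K).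
  apply: le_trans (_ : c / (4 * K * M) * V <= _).
    by rewrite ler_wpM2r // ge_min lexx.
  apply: le_trans (_ : c / (4 * K * M) * (M * Z) <= _).
    by rewrite ler_wpM2l // ltW.
  by rewrite le_eqVlt; apply/orP; left; apply/eqP; field; rewrite !gt_eqF.
have muS : mu * (beta * S) <= kappa * (beta * S).
  by rewrite ler_wpM2r ?mulr_ge0 ?ge_min ?lexx ?orbT // ltW.
have kS : kappa * (beta * S) = kappa * (eta^-1 * S) + c * S / 2.
  by rewrite /beta; field; rewrite !gt_eqF.
have ke : kappa * (eta * Z) = c * Z / (4 * K).
  by rewrite /eta; field; rewrite !gt_eqF.
have cross' : kappa * (- \sum_(i < N) vdot (s i) (x i - xs)) <=
    kappa * (eta * Z + eta^-1 * S) by rewrite ler_pM2l.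
have cZ : c * Z / (4 * K) <= c * (E + S) / 4.
  have -> : c * (E + S) / 4 = c * (K * (E + S)) / (4 * K).
    by field; rewrite !gt_eqF.
  apply: ler_wpM2r; last by rewrite ler_pM2l.
  by rewrite invr_ge0 mulr_ge0 // ltW.
rewrite mulNr mulrDr in cross' *.
lra.
Qed.

End OptimalityGap.

(** * Derivatives of vector-valued curves, gradients and Hessians *)

Section VectorCalculus.
Context {R : realType} {n : nat}.

Lemma is_derive_coord (u : R -> 'cV[R]_n) (t : R) (du : 'cV[R]_n) (k : 'I_n) :
  is_derive t (1 : R) u du -> is_derive t (1 : R) (fun r => u r k 0) (du k 0).
Proof.
move=> [dut <-]; rewrite (derive_mx dut) mxE.
by apply: derivableP; move/derivable_mxP : dut.
Qed.

Lemma is_derive_col (u : R -> 'cV[R]_n) (t : R) (du : 'cV[R]_n) :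
  (forall k, is_derive t (1 : R) (fun r => u r k 0) (du k 0)) ->
  is_derive t (1 : R) u du.
Proof.
move=> duk.
have dut : derivable u t (1 : R).
  by apply/derivable_mxP => i j; rewrite (ord1 j); case: (duk i).
apply: DeriveDef => //; rewrite (derive_mx dut).
by apply/matrixP => i j; rewrite mxE (ord1 j); case: (duk i).
Qed.

Lemma is_derive_fun_sum m (h : 'I_m -> R -> R) (t : R) (dh : 'I_m -> R) :
  (forall i, is_derive t (1 : R) (h i) (dh i)) ->
  is_derive t (1 : R) (fun r => \sum_(i < m) h i r) (\sum_(i < m) dh i).
Proof.
move=> hi; rewrite (_ : (fun r => _) = \sum_(i < m) h i).
  exact: is_derive_sum.
by apply/funext => r; rewrite fct_sumE.
Qed.

Lemma is_derive_vdot (u v : R -> 'cV[R]_n) (t : R) (du dv : 'cV[R]_n) :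
  is_derive t (1 : R) u du -> is_derive t (1 : R) v dv ->
  is_derive t (1 : R) (fun r => vdot (u r) (v r))
    (vdot du (v t) + vdot (u t) dv).
Proof.
move=> hu hv; rewrite /vdot -big_split; apply: is_derive_fun_sum => k /=.
have := is_deriveM (is_derive_coord k hu) (is_derive_coord k hv).
by move=> /is_derive_eq; apply; rewrite addrC [_ *: du k 0]mulrC.
Qed.

Lemma is_derive_along (W : normedModType R) (g : 'cV[R]_n -> W)
    (u : R -> 'cV[R]_n) (t : R) (du : 'cV[R]_n) :
  differentiable g (u t) -> is_derive t (1 : R) u du ->
  is_derive t (1 : R) (g \o u) ('D_du g (u t)).
Proof.
move=> dg [/derivable1_diffP dut duE].
have dgu : differentiable (g \o u) t by exact: differentiable_comp.
apply: DeriveDef; first exact/derivable1_diffP.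
by rewrite !deriveE // diff_comp //= -duE deriveE.
Qed.

Lemma deriveE_partial (g : 'cV[R]_n -> R) (y v : 'cV[R]_n) :
  differentiable g y -> 'D_v g y = \sum_(l < n) v l 0 * 'D_(delta_mx l 0) g y.
Proof.
move=> dg; rewrite deriveE // {1}[v]matrix_sum_delta linear_sum.
apply: eq_bigr => l _.
by rewrite big_ord1 linearZ deriveE.
Qed.

Lemma derive_grad (g : 'cV[R]_n -> R) (y v : 'cV[R]_n) :
  differentiable g y -> 'D_v g y = vdot (grad g y) v.
Proof.
move=> dg; rewrite deriveE_partial //; apply: eq_bigr => l _.
by rewrite mxE mulrC.
Qed.

Lemma derive_hess (g : 'cV[R]_n -> R) (y v : 'cV[R]_n) :
  differentiable (grad g) y -> 'D_v (grad g) y = hess g y *m v.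
Proof.
move=> dg; rewrite derive_mx; last exact: diff_derivable.
apply/matrixP => k l; rewrite !mxE (ord1 l) deriveE_partial.
  by apply: eq_bigr => j _; rewrite mxE mulrC.
exact: (differentiable_comp dg (differentiable_coord _ _ _)).
Qed.

(** A row [v] with [v *m H = 0] makes the quadratic form of [H - gamma%:M] equal to [- gamma] times
    the squared norm of [v], so [v = 0]. *)
Lemma psd_lower_unitmx (H : 'M[R]_n) (gamma : R) :
  0 < gamma -> lemx_psd gamma%:M H -> H \in unitmx.
Proof.
move=> g0 [_ hH]; rewrite -row_free_unit -kermx_eq0.
apply/eqP/row_matrixP => i; rewrite row0.
have vH : row i (kermx H) *m H = 0 by rewrite -row_mul mulmx_ker row0.
have := hH (row i (kermx H))^T.
rewrite trmxK mulmxBr vH sub0r mulNmx mxE mul_mx_scalar -scalemxAl mxE.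
rewrite -{1}[row i (kermx H)]trmxK vdotE oppr_ge0 pmulr_rle0 //.
move/vdot_le0_eq0.
by move/(congr1 trmx); rewrite trmxK trmx0.
Qed.

End VectorCalculus.

(** * The gain in closed form, and decay at a rate that blows up *)

Section Gain.
Context {R : realType} (t0 T h kappa1 : R).
Hypotheses (hT : 0 < T).

(** Near an interior time [rho] coincides with its power branch, whose logarithmic derivative is
    [h / (T + t0 - t)]. *)
Lemma gainE t : t0 < t < t0 + T ->
  gain t0 T h kappa1 t = kappa1 * h / (T + t0 - t).
Proof.
move=> /andP[t0t tT].
have q0 : 0 < T + t0 - t by lra.
have qh0 : 0 < (T + t0 - t) `^ h by rewrite powR_gt0.
have Th0 : 0 < T `^ h by rewrite powR_gt0.
have dq : is_derive t (1 : R) (fun r => T + t0 - r) (- 1).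
  by rewrite -[- 1]add0r; apply: is_deriveB.
have dp := @is_derive1_comp _ (fun r => r `^ h) (fun r => T + t0 - r) _ _ _
  (is_derive1_powR h q0) dq.
have dv := @is_deriveV _ (fun r => (T + t0 - r) `^ h) _ _ _ (lt0r_neq0 qh0) dp.
have nearE : \near t, T `^ h / (T + t0 - t) `^ h = rho t0 T h t.
  near=> r; rewrite /rho ifT //; apply/andP; split.
    by apply/ltW; near: r; exact: lt_nbhsr.
  by near: r; exact: lt_nbhsl.
have /near_eq_is_derive/(_ (is_deriveZ (T `^ h) dv))[_ drho] := nearE.
rewrite /gain /rho_dot gt_eqF // derive1E drho /rho (ltW t0t) tT /=.
rewrite -[RHS]mulrA; congr (_ * _) => /=.
have -> : (T + t0 - t) `^ (h - 1) = (T + t0 - t) `^ h / (T + t0 - t).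
  by rewrite powRB ?powRr1 ?(ltW q0) // (gt_eqF q0) implybT.
rewrite /GRing.scale /=; field.
by rewrite !gt_eqF.
Unshelve. all: by end_near. Qed.

End Gain.

Lemma powR_decay {R : realType} (U dU : R -> R) (m a b : R) : a < b ->
  (forall t, a < t < b -> is_derive t (1 : R) U (dU t)) ->
  (forall t, a < t < b -> dU t <= - (m / (b - t)) * U t) ->
  exists C, forall t, (a + b) / 2 <= t < b -> U t <= C * (b - t) `^ m.
Proof.
move=> ab hU hdU.
pose P t := U t * (b - t) `^ (- m).
have dP t : a < t < b -> is_derive t (1 : R) P
    ((b - t) `^ (- m) * (dU t + m / (b - t) * U t)).
  move=> atb; have q0 : 0 < b - t by case/andP: atb; lra.
  have dq : is_derive t (1 : R) (fun r => b - r) (- 1).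
    by rewrite -[- 1]add0r; apply: is_deriveB.
  have dp := @is_derive1_comp _ (fun r => r `^ (- m)) (fun r => b - r) _ _ _
    (is_derive1_powR _ q0) dq.
  have := is_deriveM (hU t atb) dp.
  move=> /is_derive_eq; apply.
  have -> : (b - t) `^ (- m - 1) = (b - t) `^ (- m) / (b - t).
    by rewrite powRB ?powRr1 ?(ltW q0) // (gt_eqF q0) implybT.
  by rewrite /GRing.scale /=; field; rewrite gt_eqF.
(* The comparison starts at the midpoint because nothing is assumed about [U] at [a]. *)
exists (P ((a + b) / 2)) => t /andP[t1 t2].
have q0 : 0 < b - t by lra.
have -> : U t = P t * (b - t) `^ m.
  by rewrite /P -mulrA -powRD ?addNr ?powRr0 ?mulr1 // (gt_eqF q0) implybT.
rewrite ler_pM2r ?powR_gt0 //.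
apply: (@ler0_derive1_le_oo _ P a b) => //.
- by move=> r; rewrite in_itv /= => /dP[].
- move=> r; rewrite in_itv /= => rab; rewrite derive1E.
  have [_ ->] := dP r rab; rewrite mulr_ge0_le0 ?powR_ge0 //.
  by have := hdU r rab; lra.
- move=> r; rewrite inE /= in_itv /= => /dP[/derivable1_diffP + _].
  exact: differentiable_continuous.
- by rewrite in_itv /=; lra.
- by rewrite in_itv /=; lra.
Qed.

(** * Integrals and derivatives along a solution *)

Lemma Rintegral_sum d (X : measurableType d) (R : realType)
    (mu : {measure set X -> \bar R}) (D : set X) I (s : seq I)
    (g : I -> X -> R) :
  measurable D -> (forall i, mu.-integrable D (EFin \o g i)) ->
  (\int[mu]_(r in D) (\sum_(i <- s) g i r))%R =
  \sum_(i <- s) (\int[mu]_(r in D) g i r)%R.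
Proof.
move=> mD ig; rewrite /Rintegral sum_fine; last first.
  by move=> i _; exact: (integrable_fin_num mD (ig i)).
rewrite -integral_sum //; congr fine; apply: eq_integral => r _.
by rewrite sumEFin.
Qed.

Section Trajectories.
Context {R : realType} {N n : nat} (e : rel 'I_N) (a : 'M[R]_N).
Hypothesis ha : adjacency_matrix e a.
Context (f : 'I_N -> 'cV[R]_n -> R) (gamma : 'I_N -> R).
Hypothesis hgamma : forall i, 0 < gamma i.
Hypothesis hC2 : forall i, twice_continuously_differentiable (f i).
Hypothesis hhess : forall i y, lemx_psd (gamma i)%:M (hess (f i) y).
Context (t0 T h c kappa1 kappa2 : R) (x : 'I_N -> R -> 'cV[R]_n).
Hypothesis hT : 0 < T.
Hypothesis hx : is_solution f a t0 T h c kappa1 kappa2 x.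

Let mu := @lebesgue_measure R.
Local Notation L := (disagreement a x).
Local Notation s := (s_aux f a t0 T h c kappa1 x).
Local Notation g t := (kappa1 * h / (T + t0 - t)).
(** The integrand of [s_aux] with the closed form of the gain, which is continuous up to and
    including [t0]. *)
Let w i k t : R := g t * L i t k 0.

Lemma disagreement_coord i t k :
  disagreement a x i t k 0 = \sum_(j < N) a i j * (x i t k 0 - x j t k 0).
Proof. by rewrite summxE; apply: eq_bigr => j _; rewrite !mxE. Qed.

Let w_continuous i k u : u < t0 + T -> {within `[t0, u], continuous (w i k)}.
Proof.
move=> uT.
have xc j : {within `[t0, u], continuous (fun t => x j t k 0)}.
  have [cx _] := hx j.
  have cxu : {within `[t0, u], continuous (x j)}.
    apply: continuous_subspaceW cx => r /=; rewrite !in_itv /=; lra.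
  move=> r; apply: (cvg_comp (x j) (fun M : 'cV[R]_n => M k 0) (cxu r)).
  exact: coord_continuous.
have Lc : {within `[t0, u], continuous (fun t => L i t k 0)}.
  rewrite (_ : (fun t => _) =
    (fun t => \sum_(j < N) a i j * (x i t k 0 - x j t k 0))).
    move=> r; apply: cvg_big => [|j _]; first exact: add_continuous.
    apply: cvgM; first exact: cvg_cst.
    by apply: cvgB; exact: xc.
  by apply/funext => t; exact: disagreement_coord.
have qc : {within `[t0, u], continuous (fun t => kappa1 * h / (T + t0 - t))}.
  apply: derivable_within_continuous => t; rewrite in_itv /= => /andP[_ tu].
  apply: derivableM; first exact: derivable_cst.
  apply: derivableV; first by rewrite gt_eqF //; lra.
  by apply: derivableB; [exact: derivable_cst | exact: derivable_id].
by move=> r; exact: cvgM (qc r) (Lc r).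
Qed.

Let w_integrable i k u : u < t0 + T -> mu.-integrable `[t0, u] (EFin \o w i k).
Proof.
move=> uT; apply: continuous_compact_integrable; first exact: segment_compact.
exact: w_continuous.
Qed.

(* The integrands may differ at t0, where the value of [gain] is irrelevant. *)
Let integral_gainE i k u : t0 < u < t0 + T ->
  (\int[mu]_(r in `[t0, u]) (gain t0 T h kappa1 r *: disagreement a x i r) k 0)%R
  = (\int[mu]_(r in `[t0, u]) w i k r)%R.
Proof.
move=> /andP[t0u uT].
have iw : mu.-integrable `]t0, u] (EFin \o w i k).
  apply: integrableS (w_integrable i k uT) => //.
  by move=> r /=; rewrite !in_itv /=; lra.
have E : {in `]t0, u]%classic, w i k =1
    fun r => (gain t0 T h kappa1 r *: disagreement a x i r) k 0}.
  move=> r; rewrite inE /= in_itv /= => r0u.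
  by rewrite mxE gainE //; lra.
rewrite -Rintegral_itv_obnd_cbnd; last first.
  by apply: eq_integrable iw => // r rD; rewrite /= E.
rewrite -[RHS]Rintegral_itv_obnd_cbnd //.
by apply: eq_Rintegral => r rD; rewrite E.
Qed.

(** The sum over the agents passes under the integral, where the Laplacian terms cancel at each
    time. *)
Lemma sum_s_aux t : t0 < t < t0 + T ->
  \sum_(i < N) s i t = \sum_(i < N) grad (f i) (x i t).
Proof.
move=> ht; rewrite /s_aux big_split /= -[RHS]addr0; congr (_ + _).
rewrite -scaler_sumr (_ : \sum_(i < N) _ = 0) ?scaler0 //.
apply/matrixP => k l; rewrite summxE [RHS]mxE (ord1 l).
under eq_bigr do rewrite mxE integral_gainE //.
rewrite -Rintegral_sum //; last by move=> i; apply: w_integrable; case/andP: ht.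
rewrite (_ : (fun r => _) = cst 0) ?Rintegral_cst ?mul0r //.
apply/funext => r; rewrite -mulr_sumr -summxE.
have := sum_laplacian ha (fun i => x i r).
by rewrite /laplacian /disagreement => ->; rewrite mxE mulr0.
Qed.

Let is_derive_integral i k t : t0 < t < t0 + T ->
  is_derive t (1 : R) (fun u => (\int[mu]_(r in `[t0, u])
    (gain t0 T h kappa1 r *: disagreement a x i r) k 0)%R) (w i k t).
Proof.
(* The fundamental theorem of calculus is applied on an interval that extends beyond [t] yet stays
   away from the singular time. *)
move=> /andP[t0t tT]; pose u := (t + (t0 + T)) / 2.
have [tu uT] : t < u /\ u < t0 + T by rewrite /u; lra.
have wt : {for t, continuous (w i k)}.
  have /continuous_within_itvP[|+ _ _] := @w_continuous i k u uT.
    exact: lt_trans tu.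
  by apply; rewrite in_itv /= t0t.
have [dF FE] := continuous_FTC1_closed tu (w_integrable i k uT) t0t wt.
apply: (@near_eq_is_derive _ _ _
  (fun y => (\int[mu]_(r in `[t0, y]) w i k r)%R)).
  near=> r; rewrite integral_gainE //; apply/andP; split.
    by near: r; exact: lt_nbhsr.
  by near: r; exact: lt_nbhsl.
by apply: DeriveDef => //; rewrite -derive1E.
Unshelve. all: by end_near. Qed.

(** The chain rule produces the Hessian, which cancels the inverse Hessian of the system. *)
Lemma is_derive_grad i t : t0 < t < t0 + T ->
  is_derive t (1 : R) (fun r => grad (f i) (x i r))
    (g t *: (- (kappa2 *: s i t) - c *: L i t)).
Proof.
move=> ht; have [_ /(_ t ht) dx] := hx i; have [_ dgrad _] := hC2 i.
have := is_derive_along (dgrad (x i t)) dx.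
move=> /is_derive_eq; apply.
rewrite derive_hess // mulmxA mulmxV ?mul1mx; first by rewrite gainE.
exact: psd_lower_unitmx (hgamma i) (hhess i _).
Qed.

(** The derivative of the integral term cancels the disagreement term in the derivative of the
    gradient. *)
Lemma is_derive_s_aux i t : t0 < t < t0 + T ->
  is_derive t (1 : R) (s i) (- (kappa2 * g t) *: s i t).
Proof.
move=> ht; apply: is_derive_col => k.
have dy := is_derive_coord k (is_derive_grad i ht).
have := is_deriveD dy (is_deriveZ c (is_derive_integral i k ht)).
rewrite (_ : _ + _ = fun r => s i r k 0); last first.
  apply/funext => r; rewrite /s_aux [RHS]mxE.
  by rewrite [X in _ = _ + X]mxE [X in _ = _ + _ * X]mxE.
by move=> /is_derive_eq; apply; rewrite /w /GRing.scale /= !mxE; ring.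
Qed.

(** The divergence is linearised at the moving point, so the two terms containing the velocity of
    [x i] cancel and only the derivative of the gradient remains. *)
Lemma is_derive_bregman i (y : 'cV[R]_n) t : t0 < t < t0 + T ->
  is_derive t (1 : R) (fun r => bregman (f i) y (x i r))
    (g t * vdot (- (kappa2 *: s i t) - c *: L i t) (x i t - y)).
Proof.
move=> ht; have [_ /(_ t ht) dx] := hx i; have [df _ _] := hC2 i.
have dgr := is_derive_grad i ht.
have dfx := is_derive_along (df (x i t)) dx.
have dyx : is_derive t (1 : R) (fun r => y - x i r)
    (0 - invmx (hess (f i) (x i t)) *m (gain t0 T h kappa1 t *:
       (- (kappa2 *: s i t) - c *: L i t))).
  exact: is_deriveB.
have := is_deriveB (is_deriveB (is_derive_cst (f i y) t (1 : R)) dfx)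
  (is_derive_vdot dgr dyx).
move=> /is_derive_eq; apply.
by rewrite derive_grad // !sub0r vdotNr vdotZl -[y - _]opprB vdotNr; ring.
Qed.

End Trajectories.

(** * Convergence at the prescribed time *)

Theorem theorem2 (R : realType) (N n : nat) (hN : (1 <= N)%N) (hn : (1 <= n)%N)
    (e : rel 'I_N) (a : 'M[R]_N)
    (he : undirected_graph e) (hconn : connected_graph e)
    (ha : adjacency_matrix e a)
    (f : 'I_N -> 'cV[R]_n -> R) (gamma psi Gamma : 'I_N -> R)
    (hgamma : forall i, 0 < gamma i) (hpsi : forall i, 0 < psi i)
    (hGamma : forall i, 0 < Gamma i)
    (hC2 : forall i, twice_continuously_differentiable (f i))
    (hconv : forall i, strongly_convex (gamma i) (f i))
    (hsmooth : forall i, smooth (psi i) (f i))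
    (hhess : forall i (x : 'cV[R]_n),
       lemx_psd (gamma i)%:M (hess (f i) x) /\
       lemx_psd (hess (f i) x) (Gamma i)%:M)
    (xs : 'cV[R]_n)
    (hxs : global_minimizer (fun y => \sum_(i < N) f i y) xs)
    (t0 T1 h1 c kappa1 kappa2 : R)
    (ht0 : 0 <= t0) (hT1 : 0 < T1) (hh1 : 0 < h1)
    (hc : 0 < c) (hkappa1 : 0 < kappa1) (hkappa2 : 0 < kappa2)
    (x0 : 'I_N -> 'cV[R]_n) (x : 'I_N -> R -> 'cV[R]_n)
    (hx0 : forall i, x i t0 = x0 i)
    (hx : is_solution f a t0 T1 h1 c kappa1 kappa2 x) :
  forall i : 'I_N, x i t @[t --> (t0 + T1)^'-] --> xs.
Proof.
pose s i t := s_aux f a t0 T1 h1 c kappa1 x i t.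
pose g t := kappa1 * h1 / (T1 + t0 - t).
have hlow i y : lemx_psd (gamma i)%:M (hess (f i) y) by case: (hhess i y).
(* The reference agent of the consensus bound is the one with index 0, which exists by [hN]. *)
have [beta [mu [beta0 mu0 diss]]] := lyapunov_dissipation hgamma hpsi hconv
  hsmooth hxs hconn ha (Ordinal hN) hc hkappa2.
pose U t := lyapunov f xs beta (fun i => x i t) (fun i => s i t).
pose dU t := g t * (\sum_(i < N) vdot (- (kappa2 *: s i t)
    - c *: laplacian a (fun i => x i t) i) (x i t - xs)
  + beta * \sum_(i < N) (- (2 * kappa2) * vdot (s i t) (s i t))).
have hU t : t0 < t < t0 + T1 -> is_derive t (1 : R) U (dU t).
  move=> ht.
  have dV := is_derive_fun_sum (fun i =>
    is_derive_bregman hgamma hC2 hlow hT1 hx i xs ht).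
  have dS := is_derive_fun_sum (fun i => is_derive_vdot
    (is_derive_s_aux hgamma hC2 hlow hT1 hx i ht)
    (is_derive_s_aux hgamma hC2 hlow hT1 hx i ht)).
  have := is_deriveD dV (is_deriveZ beta dS).
  move=> /is_derive_eq; apply.
  rewrite /dU mulrDr; congr (_ + _); first by rewrite mulr_sumr.
  rewrite [RHS]mulrCA; congr (beta * _); rewrite [RHS]mulr_sumr.
  apply: eq_bigr => i _; rewrite vdotZl vdotZr /g; ring.
(* The dissipation inequality is multiplied by the positive gain, which puts it in the form of
   [powR_decay] with exponent [mu * kappa1 * h1]. *)
have hdU t : t0 < t < t0 + T1 ->
    dU t <= - (mu * kappa1 * h1 / (t0 + T1 - t)) * U t.
  move=> ht; have q0 : 0 < T1 + t0 - t by lra.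
  have -> : - (mu * kappa1 * h1 / (t0 + T1 - t)) * U t = g t * (- mu * U t).
    by rewrite /g (addrC t0); ring.
  rewrite ler_pM2l; last by rewrite divr_gt0 // mulr_gt0.
  apply: diss; exact: (sum_s_aux ha hT1 hx ht).
have tT : t0 < t0 + T1 by rewrite ltrDl.
have [C hC] := powR_decay tT hU hdU.
set m := mu * kappa1 * h1 in hC.
have m0 : 0 < m by rewrite !mulr_gt0.
have q_cvg : (t0 + T1 - t) @[t --> (t0 + T1)^'-] --> (0 : R)^'+.
  move=> A [d /= d0 dA].
  suff : \forall t \near (t0 + T1)^'-, A (t0 + T1 - t) by [].
  near=> t.
  have td : t0 + T1 - d < t.
    by near: t; apply: nbhs_left_gt; rewrite ltrBlDr ltrDl.
  have tT1 : t < t0 + T1 by near: t; exact: nbhs_left_lt.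
  have q0 : 0 < t0 + T1 - t by rewrite subr_gt0.
  apply: dA => //; rewrite /ball_ /= sub0r normrN gtr0_norm //; lra.
move=> i.
have Ucvg : 2 / gamma i * (C * (t0 + T1 - t) `^ m) @[t --> (t0 + T1)^'-] --> 0.
  rewrite (_ : 0 = 2 / gamma i * (C * 0)); last by rewrite !mulr0.
  apply: cvgM; first exact: cvg_cst.
  apply: cvgM; first exact: cvg_cst.
  exact: cvg_comp q_cvg (powR_cvg0 m0).
apply/cvgrPdist_lt => eps eps0.
near=> t.
have t0t : (t0 + (t0 + T1)) / 2 <= t.
  by near: t; apply: nbhs_left_ge; lra.
have tT1 : t < t0 + T1 by near: t; exact: nbhs_left_lt.
(* Strong convexity bounds the squared distance by [2 / gamma i] times one divergence, and the other
   summands of [U] are nonnegative. *)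
have Ut : vdot (xs - x i t) (xs - x i t) < eps ^+ 2.
  apply: le_lt_trans (_ : 2 / gamma i * (C * (t0 + T1 - t) `^ m) < _).
    rewrite -ler_pdivrMl ?divr_gt0 // invf_div.
    apply: le_trans (bregman_ge (hconv i) _ _) _.
    apply: le_trans (hC t _); last by rewrite t0t.
    rewrite /U /lyapunov (bigD1 i) //= -addrA lerDl addr_ge0 //.
      by apply: sumr_ge0 => j _; exact: bregman_ge0 (hgamma j) (hconv j) _ _.
    by rewrite mulr_ge0 ?(ltW beta0) // sumr_ge0 // => j _; exact: vdot_ge0.
  near: t; have := cvgr_lt _ Ucvg; apply; exact: exprn_gt0.
(* The limit is stated in the sup norm, so the Euclidean bound is applied to each coordinate. *)
rewrite [ltLHS]/Num.Def.normr /= mx_normrE; apply: bigmax_lt => //= -[k l] _.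
rewrite (ord1 l) -(ltr_pXn2r (n := 2)) ?nnegrE ?(ltW eps0) //.
rewrite real_normK ?num_real //.
exact: le_lt_trans (coord_le_vdot _ _) Ut.
Unshelve. all: by end_near. Qed.
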